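(* Of the $14$ classes of edge-transitive maps, (i) six, namely $2\,\mathrm{ex}$, $2^*\mathrm{ex}$, $2^P\mathrm{ex}$, $5$, $5^*$ and $5^P$, are void; (ii) four, namely $1$, $2$, $2^*$ and $2^P$, are tame; and (iii) four, namely $3$, $4$, $4^*$ and $4^P$, are wild.
   Context: Let $\Gamma=\langle R_0,R_1,R_2\mid R_i^2=(R_0R_2)^2=1\rangle$ and $E=\langle R_0,R_2\rangle\cong V_4$. A (connected) map $\mathcal{M}$ (possibly non-orientable, non-compact, or with non-empty boundary) is identified, up to isomorphism, with a transitive permutation representation of $\Gamma$ on a set $\Phi$ of flags, or equivalently with a conjugacy class of subgroups $M\le\Gamma$ (its map subgroups, the stabilisers of flags). Its vertices, edges and faces are the orbits on $\Phi$ of $\langle R_1,R_2\rangle$, $\langle R_0,R_2\rangle$ and $\langle R_0,R_1\rangle$. Its automorphism group $\mathrm{Aut}\,\mathcal{M}$ is the centraliser of $\Gamma$ in $\mathrm{Sym}\,\Phi$; it is isomorphic to $N_\Gamma(M)/M$. The map is edge-transitive if $\mathrm{Aut}\,\mathcal{M}$ is transitive on edges, equivalently $\Gamma=N_\Gamma(M)E$. There are $14$ conjugacy classes of subgroups $N\le\Gamma$ with $\Gamma=NE$, represented by the following subgroups $N(T)$. $N(1)=\Gamma$. Those of index $2$ are determined by which generators $R_i$ they contain: $N(2)$ contains exactly $R_1,R_2$; $N(2^* )$ exactly $R_0,R_1$; $N(2^P)$ exactly $R_1$; $N(2\,\mathrm{ex})$ exactly $R_2$; $N(2^*\mathrm{ex})$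 exactly $R_0$; $N(2^P\mathrm{ex})$ none of them. Those of index $4$ are point stabilisers (defined up to conjugacy) in the actions of $\Gamma$ on $\{1,2,3,4\}$ with $R_0\mapsto(12)(34)$, $R_2\mapsto(14)(23)$ and $R_1\mapsto$: identity for $T=3$; $(14)$ for $T=4$; $(12)$ for $T=4^*$; $(13)$ for $T=4^P$; $(14)(23)$ for $T=5$; $(12)(34)$ for $T=5^*$; $(13)(24)$ for $T=5^P$. An edge-transitive map $\mathcal{M}$ is in class $T$ if $N_\Gamma(M)$ is conjugate to $N(T)$. A map has non-empty boundary if and only if some $R_i$ $(i=0,1,2)$ fixes a flag, equivalently $M$ contains a conjugate of some $R_i$. An edge-transitive class $T$ is called void if it contains no maps with non-empty boundary; tame if it does contain maps with non-empty boundary, but they all have dihedral automorphism groups (here $D_1\cong C_2$, $D_2\cong V_4$ and $D_\infty\cong C_2*C_2$ are included as dihedral groups, where $D_n$ has order $2n$); and wild if it contains maps with non-empty boundary which have non-dihedral automorphism groups.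
   Formalization: The map with a single flag (M = Γ) is set aside in the definitions of tame (dihedral clause) and wild: it lies in class 1, has non-empty boundary and trivial, hence non-dihedral, automorphism group, so with it class 1 would be wild, not tame. *)

(* Defs.v *)
(* MathComp, with the classical layer of MathComp-Analysis. *)
From HB Require Import structures.
From mathcomp Require Import all_boot all_algebra perm.
From mathcomp Require Import boolp classical_sets functions cardinality.

Set Implicit Arguments.
Unset Strict Implicit.
Unset Printing Implicit Defensive.

Local Open Scope group_scope.
Local Open Scope classical_set_scope.

(* Gamma is the quotient of the set of words in three letters by the           *)
(* congruence generated by the relators.  As R_i^2 is a relator, words in the  *)
(* inverses of the generators are not needed.                                  *)

Definition relators : seq (seq 'I_3) :=
  let r0 : 'I_3 := inord 0 in let r1 : 'I_3 := inord 1 in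
  let r2 : 'I_3 := inord 2 in
  [:: [:: r0; r0]; [:: r1; r1]; [:: r2; r2]; [:: r0; r2; r0; r2]].

Inductive word_eq : seq 'I_3 -> seq 'I_3 -> Prop :=
| WordRel u r v : r \in relators -> word_eq (u ++ r ++ v) (u ++ v)
| WordRefl u : word_eq u u
| WordSym u v : word_eq u v -> word_eq v u
| WordTrans u v w : word_eq u v -> word_eq v w -> word_eq u w.

Lemma word_eq_catl w u v : word_eq u v -> word_eq (w ++ u) (w ++ v).
Proof.
elim=> {u v} [u r v rr|u|u v _ /WordSym//|u v x _ uv _ vx].
- by rewrite !(catA w); apply: WordRel.
- exact: WordRefl.
- exact: WordTrans uv vx.
Qed.

Lemma word_eq_catr w u v : word_eq u v -> word_eq (u ++ w) (v ++ w).
Proof.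
elim=> {u v} [u r v rr|u|u v _ /WordSym//|u v x _ uv _ vx].
- by rewrite -!catA; apply: WordRel.
- exact: WordRefl.
- exact: WordTrans uv vx.
Qed.

Lemma word_eq_cat u v u' v' :
  word_eq u u' -> word_eq v v' -> word_eq (u ++ v) (u' ++ v').
Proof.
by move=> /(word_eq_catr v) uu' /(word_eq_catl u'); apply: WordTrans.
Qed.

Lemma relators_square (i : 'I_3) : [:: i; i] \in relators.
Proof.
rewrite !inE; case: i => [[|[|[|//]]] Hi].
- by rewrite (_ : Ordinal Hi = inord 0) ?eqxx //; apply/val_inj; rewrite /= inordK.
- by rewrite (_ : Ordinal Hi = inord 1) ?eqxx ?orbT //; apply/val_inj; rewrite /= inordK.
- by rewrite (_ : Ordinal Hi = inord 2) ?eqxx ?orbT //; apply/val_inj; rewrite /= inordK.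
Qed.

Lemma relators_rev r : r \in relators -> word_eq (rev r) [::].
Proof.
rewrite !inE => /or4P[] /eqP ->; rewrite /rev /=.
- exact: (@WordRel [::] _ [::] (relators_square _)).
- exact: (@WordRel [::] _ [::] (relators_square _)).
- exact: (@WordRel [::] _ [::] (relators_square _)).
- set a := inord 2; set b := inord 0.
  have r4 : [:: b; a; b; a] \in relators by rewrite !inE eqxx !orbT.
  have h1 : word_eq [:: a; b; a; b] [:: b; b; a; b; a; b].
    exact: WordSym (@WordRel [::] _ [:: a; b; a; b] (relators_square b)).
  have h2 : word_eq [:: b; b; a; b; a; b] [:: b; b].
    exact: (@WordRel [:: b] _ [:: b] r4).
  apply: WordTrans h1 (WordTrans h2 _).
  exact: (@WordRel [::] _ [::] (relators_square _)).
Qed.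

Lemma word_eq_rev u v : word_eq u v -> word_eq (rev u) (rev v).
Proof.
elim=> {u v} [u r v rr|u|u v _ /WordSym//|u v x _ uv _ vx].
- rewrite !rev_cat -catA; apply: word_eq_catl.
  rewrite -[X in word_eq _ X]cat0s; apply: word_eq_catr; exact: relators_rev.
- exact: WordRefl.
- exact: WordTrans uv vx.
Qed.

Lemma word_eq_revK u : word_eq (rev u ++ u) [::].
Proof.
elim: u => [|i u IHu]; first exact: WordRefl.
rewrite rev_cons -cats1 -catA.
exact: WordTrans (@WordRel (rev u) [:: i; i] u (relators_square i)) IHu.
Qed.

Definition word_eqb : rel (seq 'I_3) := fun u v => `[< word_eq u v >].

Lemma word_eqb_refl : reflexive word_eqb.
Proof. by move=> u; apply/asboolP; exact: WordRefl. Qed.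

Lemma word_eqb_sym : symmetric word_eqb.
Proof. by move=> u v; apply/asboolP/asboolP; exact: WordSym. Qed.

Lemma word_eqb_trans : transitive word_eqb.
Proof.
by move=> v u w /asboolP uv /asboolP vw; apply/asboolP; exact: WordTrans uv vw.
Qed.

Canonical word_equiv :=
  EquivRel word_eqb word_eqb_refl word_eqb_sym word_eqb_trans.

Local Open Scope quotient_scope.

Definition gamma : Type := {eq_quot word_equiv}.
HB.instance Definition _ := Choice.on gamma.

Definition gamma_of (w : seq 'I_3) : gamma := \pi_{eq_quot word_equiv} w.
Definition word_of (g : gamma) : seq 'I_3 := @repr _ {eq_quot word_equiv} g.

Lemma word_ofK : cancel word_of gamma_of.
Proof. by move=> g; rewrite /gamma_of reprK. Qed.

Lemma gamma_ofP u v : gamma_of u = gamma_of v <-> word_eq u v.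
Proof.
by split=> [/eqmodP/asboolP//|uv]; apply/eqmodP/asboolP.
Qed.

Lemma word_of_eq w : word_eq (word_of (gamma_of w)) w.
Proof. by apply/gamma_ofP; rewrite word_ofK. Qed.

Definition gamma_mul (g h : gamma) := gamma_of (word_of g ++ word_of h).
Definition gamma_inv (g : gamma) := gamma_of (rev (word_of g)).

Lemma gamma_mul_of u v : gamma_mul (gamma_of u) (gamma_of v) = gamma_of (u ++ v).
Proof. by apply/gamma_ofP/word_eq_cat; exact: word_of_eq. Qed.

Lemma gamma_inv_of u : gamma_inv (gamma_of u) = gamma_of (rev u).
Proof. by apply/gamma_ofP/word_eq_rev; exact: word_of_eq. Qed.

Lemma gamma_mulA : associative gamma_mul.
Proof.
move=> x y z; rewrite -[x]word_ofK -[y]word_ofK -[z]word_ofK.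
by rewrite !gamma_mul_of catA.
Qed.

Lemma gamma_mul1 : left_id (gamma_of [::]) gamma_mul.
Proof. by move=> x; rewrite -[x]word_ofK gamma_mul_of. Qed.

Lemma gamma_mulr1 : right_id (gamma_of [::]) gamma_mul.
Proof. by move=> x; rewrite -[x]word_ofK gamma_mul_of cats0. Qed.

Lemma gamma_mulV : left_inverse (gamma_of [::]) gamma_inv gamma_mul.
Proof.
move=> x; rewrite -[x]word_ofK gamma_inv_of gamma_mul_of.
by apply/gamma_ofP; exact: word_eq_revK.
Qed.

Lemma gamma_mulrV : right_inverse (gamma_of [::]) gamma_inv gamma_mul.
Proof.
move=> x; rewrite -[x]word_ofK gamma_inv_of gamma_mul_of.
by apply/gamma_ofP; rewrite -{1}[word_of x]revK; exact: word_eq_revK.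
Qed.

HB.instance Definition _ := isGroup.Build gamma
  gamma_mulA gamma_mul1 gamma_mulr1 gamma_mulV gamma_mulrV.

Definition R (i : 'I_3) : gamma := gamma_of [:: i].

Notation R0 := (R (inord 0)).
Notation R1 := (R (inord 1)).
Notation R2 := (R (inord 2)).

(* The homomorphism from Gamma to G given by R_i |-> h i, when the h i satisfy *)
(* the defining relations.                                                     *)
Definition gamma_hom (G : groupType) (h : 'I_3 -> G) (g : gamma) : G :=
  \prod_(i <- word_of g) h i.

Section GammaHom.
Variables (G : groupType) (h : 'I_3 -> G).
Hypothesis h_rel : forall r, r \in relators -> \prod_(i <- r) h i = 1.

Lemma word_eq_prod u v :
  word_eq u v -> \prod_(i <- u) h i = \prod_(i <- v) h i.
Proof.
elim=> {u v} [u r v rr|//|u v _ ->//|u v x _ -> _ ->//].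
by rewrite !big_cat /= (h_rel rr) mul1g.
Qed.

Lemma gamma_hom_of w : gamma_hom h (gamma_of w) = \prod_(i <- w) h i.
Proof. exact: word_eq_prod (word_of_eq w). Qed.

Lemma gamma_homM x y : gamma_hom h (x * y) = gamma_hom h x * gamma_hom h y.
Proof.
rewrite -[x]word_ofK -[y]word_ofK.
rewrite [gamma_of _ * gamma_of _]gamma_mul_of !gamma_hom_of.
by rewrite big_cat.
Qed.

Lemma gamma_homR i : gamma_hom h (R i) = h i.
Proof. by rewrite gamma_hom_of big_seq1. Qed.

End GammaHom.

Definition is_subgroup (G : groupType) (H : set G) : Prop :=
  H 1 /\ forall x y, H x -> H y -> H (x * y^-1).

Definition generated_set (G : groupType) (A : set G) : set G :=
  smallest (@is_subgroup G) A.

Definition index_eq (G : groupType) (H : set G) (n : nat) : Prop :=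
  ([set [set x * y | y in H] | x in [set: G]] #= `I_n)%card.

Definition conj_set (G : groupType) (H : set G) (g : G) : set G :=
  [set x ^ g | x in H].

Definition conjugate_sets (G : groupType) (H K : set G) : Prop :=
  exists g, conj_set H g = K.

Definition normaliser_set (G : groupType) (H : set G) : set G :=
  [set g | conj_set H g = H].

Definition E : set gamma := generated_set [set R0; R2].

Record Map := MkMap {
  flag :> Type;
  act : flag -> gamma -> flag;
  act1 : forall x, act x 1 = x;
  actM : forall x g h, act x (g * h) = act (act x g) h;
  flag_nonempty : exists x : flag, True;
  act_trans : forall x y, exists g, act x g = y }.

Definition map_subgroup (M : Map) (x : M) : set gamma := [set g | act x g = x].

Definition edges (M : Map) : set (set M) :=
  [set [set act x g | g in E] | x in [set: M]].
Arguments edges : clear implicits.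

Definition Aut_map (M : Map) : set (M -> M) :=
  [set a | bijective a /\ forall x g, a (act x g) = act (a x) g].
Arguments Aut_map : clear implicits.

Definition edge_transitive (M : Map) : Prop :=
  forall e f, edges M e -> edges M f -> exists2 a, Aut_map M a & a @` e = f.

Definition has_boundary (M : Map) : Prop := exists i (x : M), act x (R i) = x.

Inductive et_class :=
  | C1
  | C2 | C2star | C2P
  | C2ex | C2starex | C2Pex
  | C3
  | C4 | C4star | C4P
  | C5 | C5star | C5P.

Definition index2_containing (s : seq nat) (H : set gamma) : Prop :=
  [/\ is_subgroup H, index_eq H 2 & forall i : 'I_3, H (R i) <-> val i \in s].

(* The transposition (i j) of the points 1, 2, 3, 4, which are represented by  *)
(* 0, 1, 2, 3 in 'I_4.                                                         *)
Definition tp (i j : nat) : 'S_4 := tperm (inord i.-1) (inord j.-1).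

Definition action4 (s : 'S_4) (i : 'I_3) : 'S_4 :=
  match val i with
  | 0%N => tp 1 2 * tp 3 4
  | 1%N => s
  | _ => tp 1 4 * tp 2 3
  end.

Lemma action4_rel (s : 'S_4) :
  s * s = 1 -> forall r, r \in relators -> \prod_(i <- r) action4 s i = 1.
Proof.
have kk (a b c d : 'I_4) : a != c -> a != d -> b != c -> b != d ->
    (tperm a b * tperm c d) * (tperm a b * tperm c d) = 1.
  move=> ac ad bc bd; apply/permP => x; rewrite !permM perm1.
  have [->|xa] := eqVneq x a; last have [->|xb] := eqVneq x b.
  - by rewrite tpermL (@tpermD _ c d b) 1?eq_sym // tpermR tpermD // eq_sym.
  - by rewrite tpermR (@tpermD _ c d a) 1?eq_sym // tpermL tpermD // eq_sym.
  rewrite (@tpermD _ a b x) 1?eq_sym //.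
  have [->|xc] := eqVneq x c.
    by rewrite tpermL (@tpermD _ a b d) // tpermR.
  have [->|xd] := eqVneq x d.
    by rewrite tpermR (@tpermD _ a b c) // tpermL.
  by rewrite (@tpermD _ c d x) 1?eq_sym // !tpermD // eq_sym.
have t0 : action4 s (inord 0) = tp 1 2 * tp 3 4 by rewrite /action4 /= inordK.
have t1 : action4 s (inord 1) = s by rewrite /action4 /= inordK.
have t2 : action4 s (inord 2) = tp 1 4 * tp 2 3 by rewrite /action4 /= inordK.
have ne (i j : nat) : (i < 4)%N -> (j < 4)%N -> i != j ->
    inord i != inord j :> 'I_4.
  by move=> i4 j4; apply: contraNneq => /(congr1 val); rewrite /= !inordK // => ->.
move=> ss r; rewrite !inE => /or4P[] /eqP ->;
  rewrite !big_cons big_nil ?t0 ?t1 ?t2 mulg1 //.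
- by apply: kk; exact: ne.
- by apply: kk; exact: ne.
- apply/permP => x; rewrite perm1 !permM /tp /=.
  have [i i4 ->] : exists2 i : nat, (i < 4)%N & x = inord i.
    by exists x => //; rewrite inord_val.
  have p i' j' k' : (i' < 4)%N -> (j' < 4)%N -> (k' < 4)%N ->
     tperm (inord i') (inord j') (inord k') =
     inord (if k' == i' then j' else if k' == j' then i' else k') :> 'I_4.
    move=> hi hj hk; have [->|ki] := eqVneq k' i'; first exact: tpermL.
    have [->|kj] := eqVneq k' j'; first exact: tpermR.
    by apply: tpermD; apply: ne => //; rewrite eq_sym.
  by case: i i4 => [|[|[|[|//]]]] _; rewrite !p.
Qed.

Definition point_stabiliser4 (s : 'S_4) (H : set gamma) : Prop :=
  exists p : 'I_4, H = [set g | gamma_hom (action4 s) g p = p].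

(* H is one of the choices for N(T).                                           *)
Definition is_N (T : et_class) (H : set gamma) : Prop :=
  match T with
  | C1 => H = [set: gamma]
  | C2 => index2_containing [:: 1; 2]%N H
  | C2star => index2_containing [:: 0; 1]%N H
  | C2P => index2_containing [:: 1]%N H
  | C2ex => index2_containing [:: 2]%N H
  | C2starex => index2_containing [:: 0]%N H
  | C2Pex => index2_containing [::] H
  | C3 => point_stabiliser4 1 H
  | C4 => point_stabiliser4 (tp 1 4) H
  | C4star => point_stabiliser4 (tp 1 2) H
  | C4P => point_stabiliser4 (tp 1 3) H
  | C5 => point_stabiliser4 (tp 1 4 * tp 2 3) H
  | C5star => point_stabiliser4 (tp 1 2 * tp 3 4) H
  | C5P => point_stabiliser4 (tp 1 3 * tp 2 4) H
  end.

Definition in_class (T : et_class) (M : Map) : Prop :=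
  edge_transitive M /\
  exists (x : M) (H : set gamma),
    is_N T H /\ conjugate_sets (normaliser_set (map_subgroup x)) H.

(* The generalised dihedral group of A, the semidirect product of A by the     *)
(* group of order 2 acting by inversion; (a, true) is a reflection.            *)
Definition Dih (A : zmodType) : Type := (A * bool)%type.

Section Dih.
Variable A : zmodType.
Local Open Scope ring_scope.

HB.instance Definition _ := Choice.on (Dih A).

Definition Dih_mul (x y : Dih A) : Dih A :=
  (x.1 + (if x.2 then - y.1 else y.1), x.2 (+) y.2).
Definition Dih_one : Dih A := (0, false).
Definition Dih_inv (x : Dih A) : Dih A := ((if x.2 then x.1 else - x.1), x.2).

Lemma Dih_mulA : associative Dih_mul.
Proof.
move=> [a s] [b t] [c u]; congr pair => /=; last exact: addbA.
by case: s; case: t; rewrite /= ?GRing.opprD ?GRing.opprK GRing.addrA.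
Qed.

Lemma Dih_mul1 : left_id Dih_one Dih_mul.
Proof. by move=> [a s]; rewrite /Dih_mul /= GRing.add0r. Qed.

Lemma Dih_mulr1 : right_id Dih_one Dih_mul.
Proof.
by move=> [a s]; rewrite /Dih_mul /= GRing.oppr0 if_same GRing.addr0 addbF.
Qed.

Lemma Dih_mulV : left_inverse Dih_one Dih_inv Dih_mul.
Proof.
by move=> [a []]; rewrite /Dih_mul /Dih_one /= ?GRing.subrr ?GRing.addNr.
Qed.

Lemma Dih_mulrV : right_inverse Dih_one Dih_inv Dih_mul.
Proof. by move=> [a []]; rewrite /Dih_mul /Dih_one /= GRing.subrr. Qed.

HB.instance Definition _ := isGroup.Build (Dih A)
  Dih_mulA Dih_mul1 Dih_mulr1 Dih_mulV Dih_mulrV.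

End Dih.

Definition Aut_isog (M : Map) (G : groupType) : Prop :=
  exists phi : G -> (M -> M),
    [/\ injective phi, forall g h, phi (g * h) = phi g \o phi h
      & range phi = Aut_map M].

(* 'I_n.+1 carries the addition modulo n.+1, so that Dih 'I_n.+1 is D_n.+1, of *)
(* order 2(n+1); Dih int is D_oo.  The trivial group is not dihedral.          *)
Definition dihedral_Aut (M : Map) : Prop :=
  (exists n : nat, Aut_isog M (Dih 'I_n.+1)) \/ Aut_isog M (Dih int).

(* The map with a single flag (with M = Gamma, hence in class 1) has non-empty *)
(* boundary and trivial automorphism group.  It is the one degenerate case set *)
(* aside in tame_class and wild_class: with it, class 1 would not be tame.     *)
Definition one_flag (M : Map) : Prop := forall x y : M, x = y.

Definition void_class (T : et_class) : Prop :=
  forall M, in_class T M -> ~ has_boundary M.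

Definition tame_class (T : et_class) : Prop :=
  (exists2 M, in_class T M & has_boundary M) /\
  forall M, in_class T M -> has_boundary M -> ~ one_flag M -> dihedral_Aut M.

Definition wild_class (T : et_class) : Prop :=
  exists M, [/\ in_class T M, has_boundary M, ~ one_flag M & ~ dihedral_Aut M].

(* Main.v *)
Require Import Defs.
From mathcomp Require Import all_boot all_algebra perm.
From mathcomp Require Import boolp classical_sets functions cardinality.
From mathcomp Require Import zify.

Set Implicit Arguments.
Unset Strict Implicit.
Unset Printing Implicit Defensive.

Local Open Scope classical_set_scope.
Local Open Scope group_scope.

(** Let [M_x] be the stabiliser of a flag [x] and [N] its normaliser in [gamma].
    Automorphisms of the map are the maps [x h |-> x g h] with [g] in [N], and
    non-empty boundary means that some generator [R i] lies in [M_x], hence in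
    [N], for a suitable [x].

    Void classes.  For [C2Pex], [C5], [C5star] and [C5P] no conjugate of a
    generator lies in [N] ([void_2Pex], [void_5]).  For [C2ex] and [C2starex] the
    only generator in [N] is one of [R 0] and [R 2]; if it lies in [M_x], then
    [N] is cyclic modulo [M_x], and the other of these two inverts the cyclic
    quotient.  So it normalises [M_x] although it is outside [N], which is absurd
    ([ex_not_boundary]).

    Tame classes.  [N] is the whole group or has index two, and Schreier's method
    shows that it is generated by three involutions, one of which lies in [M_x], so
    that two involutions generate [N] modulo [M_x] ([dihedral_criterion]).  So the
    automorphism group is a quotient of the infinite dihedral group, and a
    non-trivial such quotient is dihedral ([dihedral_of_hom]).

    Wild classes.  Given the action of [gamma] on a finite set [B] and a finite
    abelian group [A], let [R 1] also add to the [A]-coordinate of a flag in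
    [B * A] a voltage depending on its [B]-coordinate.  If exactly one point [b0]
    of [B] is fixed by [R 1] with voltage zero, automorphisms must preserve the
    fibre above [b0], so they are the translations by [A], and the normaliser is
    the stabiliser of [b0] in the action on [B] ([cover_normaliser]).  For the
    four actions on four points, voltages in an elementary abelian group of order
    eight or a cyclic group of order six work, and an abelian group of order
    greater than four is not dihedral ([cover_not_dihedral]).  The same
    construction over one or two points gives maps with boundary in the tame
    classes. *)

(** * Flag stabilisers and automorphisms *)

Lemma I3_cases (P : 'I_3 -> Prop) :
  P (inord 0) -> P (inord 1) -> P (inord 2) -> forall i, P i.
Proof.
move=> P0 P1 P2 i; rewrite -[i]inord_val.
by case: i => [[|[|[|]]] ?].
Qed.

Lemma I3_gen02 k : [\/ k = inord 0, k = inord 2 | k = inord 1 :> 'I_3].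
Proof. by move: k; apply: I3_cases; [constructor 1|constructor 3|constructor 2]. Qed.

Lemma I3_gen20 k : [\/ k = inord 2, k = inord 0 | k = inord 1 :> 'I_3].
Proof. by move: k; apply: I3_cases; [constructor 2|constructor 3|constructor 1]. Qed.

Lemma gamma_ind (P : gamma -> Prop) :
  P 1 -> (forall g i, P g -> P (g * R i)) -> forall g, P g.
Proof.
move=> P1 PR g; rewrite -[g]word_ofK; elim/last_ind: (word_of g) => [//|w i].
by move=> /(PR _ i); rewrite [gamma_of w * _]gamma_mul_of cats1.
Qed.

Lemma R_sq i : R i * R i = 1.
Proof.
rewrite [R i * R i]gamma_mul_of; apply/gamma_ofP.
exact: (@WordRel [::] _ [::] (relators_square _)).
Qed.

Lemma R_inv i : (R i)^-1 = R i.
Proof. exact/mulg1_eq/R_sq. Qed.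

Lemma R02_comm : R (inord 0) * R (inord 2) = R (inord 2) * R (inord 0).
Proof.
suff /mulg1_eq <- : R (inord 0) * R (inord 2) * (R (inord 0) * R (inord 2)) = 1.
  by rewrite invgM !R_inv.
rewrite [R _ * R _]gamma_mul_of [gamma_of _ * _]gamma_mul_of; apply/gamma_ofP.
have rel : [:: inord 0; inord 2; inord 0; inord 2] \in relators.
  by rewrite !inE eqxx !orbT.
exact: (@WordRel [::] _ [::] rel).
Qed.

Section MapSubgroup.
Variables (M : Map) (x : M).

Local Notation N := (normaliser_set (map_subgroup x)).

Lemma act_div g h : act x (g * h^-1) = x <-> act x g = act x h.
Proof.
split=> [e|e]; first by rewrite -[g](mulgVK h) actM e.
by rewrite actM e -actM mulgV act1.
Qed.

(** Normalising the stabiliser of [x] means that [x] and [act x g] have the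
    same stabiliser, which is what makes [act x h |-> act x (g * h)] well
    defined. *)
Lemma normaliserP g :
  N g <-> forall h, act x (g * h) = act x g <-> act x h = x.
Proof.
split=> [Ng h|Ng]; last first.
  apply/seteqP; split=> [_ [m /= xm <-]|h /= xh].
    by apply/Ng; rewrite conjgE mulgA mulgV mul1g actM xm.
  exists (h ^ g^-1); last by rewrite conjgKV.
  by rewrite /map_subgroup /= conjgE invgK mulgA; apply/act_div/Ng.
split=> [xgh|xh].
  rewrite -[act x h = x]/(map_subgroup x h) -[X in X h]Ng.
  exists (g * h * g^-1); last by rewrite conjgE mulgVK mulKg.
  exact/act_div.
have: map_subgroup x h by [].
rewrite -[X in X h]Ng => -[m xm <-].
by rewrite conjgE mulgA mulgV mul1g actM xm.
Qed.

Lemma normaliser_act g h k :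
  N g -> act x (g * h) = act x (g * k) <-> act x h = act x k.
Proof.
move=> /normaliserP/(_ (h * k^-1)) Ng; split=> [e|/act_div/Ng].
  by apply/act_div/Ng; rewrite mulgA actM e -actM mulgK.
by move=> e; rewrite [RHS]actM -e -actM -mulgA mulgVK.
Qed.

Lemma normaliser1 : N 1.
Proof. by apply/normaliserP => h; rewrite mul1g act1. Qed.

Lemma normaliserM g h : N g -> N h -> N (g * h).
Proof.
move=> Ng /normaliserP Nh; apply/normaliserP => k; rewrite -mulgA.
by split=> [/(normaliser_act _ _ Ng)/Nh|/Nh/(normaliser_act _ _ Ng)].
Qed.

Lemma normaliserV g : N g -> N g^-1.
Proof.
move=> Ng; apply/normaliserP => h.
rewrite -(normaliser_act _ _ Ng) mulVKg mulgV act1.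
by split.
Qed.

Lemma stabiliser_normalises g : act x g = x -> N g.
Proof. by move=> xg; apply/normaliserP => h; rewrite actM xg. Qed.

(** The automorphism taking [x] to [act x g]; this is meaningful only for [g] in
    the normaliser. *)
Definition aut_of (g : gamma) (y : M) : M :=
  act x (g * projT1 (cid (act_trans x y))).

Lemma aut_ofE g h : N g -> aut_of g (act x h) = act x (g * h).
Proof. by rewrite /aut_of => Ng; case: cid => k /= ?; apply/normaliser_act. Qed.

Lemma aut_of_base g : N g -> aut_of g x = act x g.
Proof. by move=> Ng; have := aut_ofE 1 Ng; rewrite act1 mulg1. Qed.

Lemma aut_of1 : aut_of 1 = id.
Proof.
apply/funext => y; have [h <-] := act_trans x y.
by rewrite aut_ofE ?mul1g //; exact: normaliser1.
Qed.

Lemma aut_ofM g h : N g -> N h -> aut_of (g * h) = aut_of g \o aut_of h.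
Proof.
move=> Ng Nh; apply/funext => y; have [k <-] := act_trans x y.
by rewrite /= !aut_ofE ?mulgA //; exact: normaliserM.
Qed.

Lemma aut_ofP g : N g -> Aut_map M (aut_of g).
Proof.
move=> Ng; split.
  exists (aut_of g^-1) => y.
    rewrite -[LHS]/((aut_of g^-1 \o aut_of g) y) -aut_ofM ?mulVg ?aut_of1 //.
    exact: normaliserV.
  rewrite -[LHS]/((aut_of g \o aut_of g^-1) y) -aut_ofM ?mulgV ?aut_of1 //.
  exact: normaliserV.
by move=> y k; have [h <-] := act_trans x y; rewrite -actM !aut_ofE // mulgA actM.
Qed.

Lemma normaliser_AutP g : N g <-> exists2 a, Aut_map M a & a x = act x g.
Proof.
split=> [Ng|[a [/bij_inj a_inj aM] ax]].
  by exists (aut_of g); [exact: aut_ofP|exact: aut_of_base].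
by apply/normaliserP => h; rewrite actM -ax -aM; split=> [/a_inj|->].
Qed.

Lemma Aut_map_aut_of a : Aut_map M a -> exists2 g, N g & a = aut_of g.
Proof.
move=> aA; have [g xg] := act_trans x (a x).
have Ng : N g by apply/normaliser_AutP; exists a.
exists g => //; apply/funext => y; have [h <-] := act_trans x y.
by rewrite aA.2 -xg aut_ofE // actM.
Qed.

End MapSubgroup.

Lemma Aut_map_inj (M : Map) (x : M) a b :
  Aut_map M a -> Aut_map M b -> a x = b x -> a = b.
Proof.
move=> [_ aM] [_ bM] e; apply/funext => y.
by have [h <-] := act_trans x y; rewrite aM bM e.
Qed.

Lemma normaliser_translate (M : Map) (x : M) k g :
  normaliser_set (map_subgroup (act x k)) g <->
  normaliser_set (map_subgroup x) (k * g * k^-1).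
Proof.
split=> /normaliser_AutP[a [ab aM] e]; apply/normaliser_AutP; exists a => //.
  by rewrite !actM -e aM -actM mulgV act1.
by rewrite aM e -!actM mulgVK.
Qed.

(** Moving the base flag conjugates the normaliser of its stabiliser. *)
Lemma in_class_normaliser T (M : Map) :
  in_class T M -> exists2 H, is_N T H &
    forall y : M, exists g, forall h,
      normaliser_set (map_subgroup y) h <-> H (h ^ g).
Proof.
move=> [_ [x [H [TH [g eH]]]]]; exists H => // y.
have [k <-] := act_trans x y; exists (k^-1 * g) => h.
rewrite normaliser_translate conjgM (conjgE h) invgK mulgA -eH.
split=> [Nh|[m Nm /conjg_inj <-]//]; by exists (k * h * k^-1).
Qed.

(** * Subgroups of index two *)

Section Parity.
Variables (G : groupType) (chi : G -> bool).
Hypothesis chiM : {morph chi : x y / x * y >-> x (+) y}.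

Lemma parity1 : chi 1 = false.
Proof. by have := chiM 1 1; rewrite mulg1; case: (chi 1). Qed.

Lemma parityV g : chi g^-1 = chi g.
Proof.
by have := chiM g^-1 g; rewrite mulVg parity1; case: (chi g^-1); case: (chi g).
Qed.

Lemma parityJ g h : chi (g ^ h) = chi g.
Proof. by rewrite conjgE !chiM parityV addbC addbK. Qed.

End Parity.

Section Index2.
Variables (G : groupType) (H : set G).

Lemma subgroup_mulr x y : is_subgroup H -> H y -> H (x * y) <-> H x.
Proof.
move=> [H1 HB] Hy; split=> Hx; first by rewrite -(mulgK y x); exact: HB.
by rewrite -[y]invgK; apply: (HB) => //; rewrite -[y^-1]mul1g; exact: HB.
Qed.

(** Elements outside a subgroup of index two all lie in the same coset, so
    that membership is governed by a homomorphism onto the group of order two,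
    which is encoded as the booleans under exclusive or. *)
Lemma index2_parity : is_subgroup H -> index_eq H 2 ->
  {morph (fun g => ~~ `[< H g >]) : x y / x * y >-> x (+) y}.
Proof.
move=> HG /card_set_bijP[f [fI finj _]]; have [H1 HB] := HG.
pose coset x := [set x * y | y in H].
have cosetP x y : coset x = coset y -> H (x^-1 * y).
  move=> e; have [z Hz <-] : coset x y by rewrite e; exists 1; rewrite ?mulg1.
  by rewrite mulKg.
have flt x : (f (coset x) < 2)%N by apply: fI; exists x.
have fcoset x y : f (coset x) = f (coset y) -> H (x^-1 * y).
  move=> e; apply/cosetP/finj => //; apply/mem_set; first by exists x.
  by exists y.
have HV x : H x^-1 <-> H x.
  by split=> Hx; [rewrite -[x]invgK|]; rewrite -[_^-1]mul1g; exact: HB.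
have out x y : ~ H x -> ~ H y -> H (x * y).
  move=> Hx Hy; rewrite -[x]invgK; apply: (fcoset).
  have: f (coset 1) <> f (coset x^-1).
    by move=> /fcoset; rewrite invg1 mul1g HV.
  have: f (coset 1) <> f (coset y).
    by move=> /fcoset; rewrite invg1 mul1g.
  by have := (flt 1, flt y, flt x^-1) => -[[]];
    case: (f _) (f _) (f _) => [|[]] // [|[]] // [|[]].
move=> x y; have [Hy|Hy] := asboolP (H y).
  by rewrite addbF; congr negb; apply/asboolP/asboolP; rewrite subgroup_mulr.
have [Hx|Hx] := asboolP (H x).
  apply/asboolP => Hxy; apply: Hy; rewrite -(mulKg x y) subgroup_mulr //.
  exact/HV.
by apply/negbTE; rewrite negbK; apply/asboolP; exact: out.
Qed.

Lemma parity_index2 (chi : G -> bool) :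
  {morph chi : x y / x * y >-> x (+) y} -> (exists g, chi g) ->
  (forall g, H g <-> chi g = false) -> is_subgroup H /\ index_eq H 2.
Proof.
move=> chiM [t ct] HP.
have chi1 := parity1 chiM.
have H1 : H 1 by apply/HP.
split; first by split=> // x y /HP Hx /HP Hy; apply/HP; rewrite chiM (parityV chiM) Hx Hy.
have cosetE x : [set x * y | y in H] = [set z | chi z = chi x].
  apply/seteqP; split=> [_ [y /HP Hy <-] /=|z /= e]; first by rewrite chiM Hy addbF.
  by exists (x^-1 * z); rewrite ?mulVKg //; apply/HP; rewrite chiM (parityV chiM) e addbb.
apply/card_set_bijP; exists (fun A => ~~ `[< A 1 >] : nat); split.
- by move=> _ [x _ <-] /=; case: (`[< _ >]).
- move=> _ _ /set_mem[x _ <-] /set_mem[y _ <-]; rewrite !cosetE /= chi1.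
  by case: asboolP => [<-|]; case: asboolP => [<- //|]; case: (chi x) (chi y) => [] [].
move=> [|[|//]] _; [exists [set 1 * y | y in H]|exists [set t * y | y in H]].
- by exists 1.
- by rewrite cosetE /=; case: asboolP.
- by exists t.
- by rewrite cosetE /= chi1 ct; case: asboolP.
Qed.

End Index2.


Lemma index2_normaliser T s (M : Map) : in_class T M ->
    (forall H, is_N T H -> index2_containing s H) ->
  exists chi : gamma -> bool,
    [/\ {morph chi : x y / x * y >-> x (+) y},
        forall i, chi (R i) = (val i \notin s)
      & forall (x : M) g, normaliser_set (map_subgroup x) g <-> chi g = false].
Proof.
move=> /in_class_normaliser[H TH NP] /(_ H TH)[HG H2 HR].
have chiM := index2_parity HG H2.
exists (fun g => ~~ `[< H g >]); split=> // [i|x g].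
  by congr negb; apply/asboolP/idP => /HR.
have [h Nh] := NP x; rewrite Nh -(parityJ chiM g h).
by split=> [/asboolP ->|/negbFE/asboolP].
Qed.

(** * Powers and homomorphisms from the infinite dihedral group *)

Section IntegerPowers.
Variable G : groupType.
Implicit Types (c x y : G) (k l : int).

Definition zexpg c k : G :=
  match k with Posz n => c ^+ n | Negz n => c ^- n.+1 end.

Lemma zexpgS c k : zexpg c (k + 1)%R = zexpg c k * c.
Proof.
case: k => [n|n]; first by rewrite /= addn1 expgSr.
have -> : (Negz n + 1 = - Posz n)%R.
  by rewrite NegzE -addn1 PoszD GRing.opprD GRing.addrNK.
by case: n => [|n]; rewrite -?NegzE /= ?mulVg // [c ^+ n.+2]expgS invgM mulgVK.
Qed.

Lemma zexpgD c k l : zexpg c (k + l)%R = zexpg c k * zexpg c l.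
Proof.
have zexpgP m : zexpg c (m - 1)%R = zexpg c m * c^-1.
  by rewrite -{2}[m](GRing.subrK 1%R) zexpgS mulgK.
elim/int_rect: l => [|n IH|n IH]; first by rewrite GRing.addr0 mulg1.
  by rewrite -addn1 PoszD GRing.addrA !zexpgS IH mulgA.
by rewrite -addn1 PoszD GRing.opprD GRing.addrA !zexpgP IH mulgA.
Qed.

Lemma zexpgN c k : zexpg c (- k)%R = (zexpg c k)^-1.
Proof. by apply/esym/mulg1_eq; rewrite -zexpgD GRing.subrr. Qed.

Lemma zexpVg c k : zexpg c^-1 k = (zexpg c k)^-1.
Proof. by case: k => n /=; rewrite expVgn. Qed.

Lemma zexpgJ c k x : zexpg c k ^ x = zexpg (c ^ x) k.
Proof. by case: k => n /=; rewrite ?conjVg conjXg. Qed.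

(** When [x] and [y] are involutions this is the homomorphism taking the generating
    reflections [(1, true)] and [(0, true)] to [x] and [y]. *)
Definition dihedral_hom x y (d : Dih int) : G := zexpg (x * y) d.1 * y ^+ d.2.

Lemma dihedral_homM x y d e : x * x = 1 -> y * y = 1 ->
  dihedral_hom x y (d * e) = dihedral_hom x y d * dihedral_hom x y e.
Proof.
move=> xx yy; case: d e => [k s] [l t]; rewrite /dihedral_hom /= zexpgD.
case: s => /=; last by rewrite mulg1 mulgA.
have xyJ : (x * y) ^ y = (x * y)^-1.
  by rewrite conjgE invgM (mulg1_eq xx) (mulg1_eq yy) -mulgA yy mulg1.
rewrite zexpgN -zexpVg -xyJ -zexpgJ conjgE (mulg1_eq yy) -!mulgA.
by case: t => /=; rewrite ?expg1 ?expg0 ?yy ?mulg1.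
Qed.

End IntegerPowers.

(** * Void classes *)

Lemma normaliser_zexp (M : Map) (x : M) c k :
  normaliser_set (map_subgroup x) c ->
  normaliser_set (map_subgroup x) (zexpg c k).
Proof.
move=> Nc; have Nn n : normaliser_set (map_subgroup x) (c ^+ n).
  by elim: n => [|n IH]; [exact: normaliser1|rewrite expgS; exact: normaliserM].
by case: k => n /=; [|apply: normaliserV].
Qed.

(** Write [a], [b], [r] for [R i], [R j], [R (inord 1)].  If [a] fixes [x], then
    modulo the stabiliser of [x] the normaliser, which has index two, is generated
    by [c = b * r], and conjugation by [b] inverts [c].  So [b] would normalise
    the stabiliser of [x], although its parity puts it outside the normaliser. *)
Lemma ex_not_boundary (M : Map) (x : M) (chi : gamma -> bool) i j :
    (forall k, [\/ k = i, k = j | k = inord 1]) -> R i * R j = R j * R i ->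
    {morph chi : x y / x * y >-> x (+) y} ->
    (forall g, normaliser_set (map_subgroup x) g <-> chi g = false) ->
    chi (R i) = false -> chi (R j) -> chi (R (inord 1)) ->
  act x (R i) <> x.
Proof.
set a := R i; set b := R j; set r := R (inord 1) => gen ab chiM NP ca cb cr xa.
pose c := b * r.
have Nc : normaliser_set (map_subgroup x) c by apply/NP; rewrite chiM cb cr.
have bb : b * b = 1 by exact: R_sq.
have bV : b^-1 = b by exact: R_inv.
have cV : c^-1 = r * b by rewrite invgM !R_inv.
(* Modulo the stabiliser of [x], every [g] is [c^k * b^e], and conjugating [g] by
   [b] changes the sign of [k]. *)
have step g : exists k (e : bool),
    act x g = act x (zexpg c k * b ^+ e) /\
    act x (g ^ b) = act x (zexpg c (- k)%R * b ^+ e).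
  have Nz k := normaliser_zexp k Nc.
  have xza k : act x (zexpg c k * a) = act x (zexpg c k).
    by rewrite -[X in _ = X]act1 -!actM mulg1 -[X in _ = act x X]mulg1;
      apply/(normaliser_act _ _ (Nz k)); rewrite xa act1.
  have xzba k : act x (zexpg c k * b * a) = act x (zexpg c k * b).
    by rewrite -mulgA -ab mulgA actM xza -actM.
  elim/gamma_ind: g => [|g l [k [e [IH1 IH2]]]].
    by exists 0%R, false; rewrite conj1g /= mulg1.
  have [->|->|->] := gen l; rewrite conjMg (actM x g) (actM x (g ^ b)) IH1 IH2 -!actM.
  - exists k, e.
    have -> : R i ^ b = a by rewrite conjgE -/a ab mulKg.
    by case: e {IH1 IH2}; rewrite /= ?expg1 ?mulg1 ?xzba ?xza.
  - exists k, (~~ e).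
    have -> : R j ^ b = b by rewrite conjgE mulKg.
    by case: e {IH1 IH2} => /=; rewrite ?expg1 ?expg0 ?mulg1 -?mulgA ?bb ?mulg1.
  have rb : R (inord 1) ^ b = c * b by rewrite conjgE bV mulgA.
  case: e {IH1 IH2}; rewrite rb /= ?expg1 ?expg0.
    exists (k + 1)%R, false; rewrite GRing.opprD zexpgS zexpgD /= !mulg1 -!mulgA.
    split=> //; congr (act x (_ * _)).
    by rewrite expg1 cV /c !mulgA bb mul1g.
  exists (k - 1)%R, true; rewrite GRing.opprB [(1 - k)%R]GRing.addrC zexpgS zexpgD.
  by rewrite /= !mulg1 !expg1 cV -!mulgA bb mulg1.
have Nb : normaliser_set (map_subgroup x) b.
  have inv g : act x g = x -> act x (g ^ b) = x.
    move=> xg; have [k [e [xk xkb]]] := step g.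
    have Nz := normaliser_zexp k Nc; have /NP cz := Nz.
    (* The parity of [g] is that of the power of [b], so that power is trivial. *)
    have e0 : e = false.
      have /NP : normaliser_set (map_subgroup x) (zexpg c k * b ^+ e).
        by apply: stabiliser_normalises; rewrite -xk.
      by case: (e); rewrite chiM cz // expg1 cb.
    move: xkb xk; rewrite e0 !mulg1 xg zexpgN => -> e'.
    by rewrite -[_^-1]mul1g; apply/act_div; rewrite act1.
  apply/normaliserP => h; split=> [xh|/inv xh].
    have /inv : act x (b * h * b^-1) = x by exact/act_div.
    by rewrite conjgE mulgVK mulKg.
  by apply/act_div; move: xh; rewrite conjgE !bV mulgA.
by move: Nb => /NP; rewrite cb.
Qed.

Lemma void_2ex T i j :
    (forall H, is_N T H -> index2_containing [:: val i] H) ->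
    (forall k, [\/ k = i, k = j | k = inord 1]) ->
    i != j -> i != inord 1 -> R i * R j = R j * R i ->
  void_class T.
Proof.
move=> TN gen ij i1 ab M TM [k [x xk]].
have [chi [chiM chiR NP]] := index2_normaliser TM TN.
have chiE l : chi (R l) = (l != i) by rewrite chiR inE.
have ki : k = i.
  by apply/eqP; rewrite -[_ == _]negbK -chiE; have /NP -> := stabiliser_normalises xk.
apply: (@ex_not_boundary M x chi i j) => //; rewrite ?chiE ?eqxx // 1?eq_sym //.
by rewrite -ki.
Qed.

Lemma void_C2ex : void_class C2ex.
Proof.
apply: (@void_2ex _ (inord 2) (inord 0)) => [H||||].
- by rewrite /= inordK.
- exact: I3_gen20.
- by rewrite -val_eqE /= !inordK.
- by rewrite -val_eqE /= !inordK.
- exact: esym R02_comm.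
Qed.

Lemma void_C2starex : void_class C2starex.
Proof.
apply: (@void_2ex _ (inord 0) (inord 2)) => [H||||].
- by rewrite /= inordK.
- exact: I3_gen02.
- by rewrite -val_eqE /= !inordK.
- by rewrite -val_eqE /= !inordK.
- exact: R02_comm.
Qed.

Lemma void_2Pex : void_class C2Pex.
Proof.
move=> M TM [i [x xi]].
have [chi [_ chiR NP]] := index2_normaliser TM (fun H NH => NH).
by have /NP := stabiliser_normalises xi; rewrite chiR.
Qed.

Lemma tp_val i j (p : 'I_4) : (0 < i <= 4)%N -> (0 < j <= 4)%N ->
  val (tp i j p) =
    if val p == i.-1 then j.-1 else if val p == j.-1 then i.-1 else val p.
Proof.
move=> iP jP.
have inordE k : (0 < k <= 4)%N -> val (inord k.-1 : 'I_4) = k.-1.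
  by case: k => // k k4; rewrite /= inordK.
rewrite /tp; case: tpermP => [->|->|/eqP pi /eqP pj].
- by rewrite !inordE ?eqxx.
- by rewrite !inordE ?eqxx //; case: eqP => [->|].
- move: pi pj; rewrite -!val_eqE !inordE //.
  by do 2!case: ifP => // _.
Qed.

(** A flag fixed by [R i] puts [R i], up to conjugacy, in the stabiliser of a point
    of the action on four points, so [R i] would fix some point there. *)
Lemma void_fixfree T s : (forall H, is_N T H -> point_stabiliser4 s H) ->
  s * s = 1 -> (forall i p, action4 s i p <> p) -> void_class T.
Proof.
move=> TN ss free M /in_class_normaliser[H /TN[p ->] NP] [i [x xi]].
have [h Nh] := NP x; have /Nh /= := stabiliser_normalises xi.
have homM := gamma_homM (action4_rel ss).
rewrite conjgE !homM (gamma_homR (action4_rel ss)) !permM => e.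
pose q := gamma_hom (action4 s) h^-1 p.
apply: (free i q); apply: (@perm_inj _ (gamma_hom (action4 s) h)).
rewrite {}e /q -permM -homM mulVg.
by rewrite -[1]/(gamma_of [::]) (gamma_hom_of (action4_rel ss)) big_nil perm1.
Qed.

Lemma perm4_eq (s t : 'S_4) :
  (forall p : 'I_4, val (s p) = val (t p)) -> s = t.
Proof. by move=> st; apply/permP => p; apply/val_inj/st. Qed.

Lemma void_5 s T : (forall H, is_N T H -> point_stabiliser4 s H) ->
  s \in [:: tp 1 4 * tp 2 3; tp 1 2 * tp 3 4; tp 1 3 * tp 2 4] -> void_class T.
Proof.
move=> TN sE; apply: (void_fixfree TN).
  apply: perm4_eq => p; rewrite perm1.
  move: sE; rewrite !inE => /or3P[] /eqP ->; rewrite !permM !tp_val //;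
  by case: p => [[|[|[|[|]]]]].
have free p : s p <> p.
  move=> /(congr1 val).
  move: sE; rewrite !inE => /or3P[] /eqP ->; rewrite !permM !tp_val //;
  by case: p => [[|[|[|[|]]]]].
apply: I3_cases => p; rewrite /action4 /= inordK // => /(congr1 val);
  rewrite ?permM ?tp_val //; by case: p => [[|[|[|[|]]]]].
Qed.

(** * Quotients of the infinite dihedral group *)

Lemma DihE (A : zmodType) (a b : A) s t :
  ((a, s) : Dih A) * ((b, t) : Dih A) = ((a + (if s then - b else b))%R, s (+) t).
Proof. by []. Qed.

Section DihedralQuotient.
Variables (M : Map) (f : Dih int -> M -> M).
Hypothesis fM : forall d e, f (d * e) = f d \o f e.
Hypothesis f_range : range f = Aut_map M.

Local Notation rot k := ((k%R : int, false) : Dih int).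
Local Notation refl k := ((k%R : int, true) : Dih int).

Let f1 : f 1 = id.
Proof.
have: Aut_map M id by split=> //; exists id.
by rewrite -f_range => -[d _ fd]; have := fM 1 d; rewrite mul1g fd.
Qed.

Let fV d : f d = id -> f d^-1 = id.
Proof. by move=> fd; have := fM d d^-1; rewrite mulgV fd f1. Qed.

Let fF d e : f d = f e -> f (d * e^-1) = id.
Proof. by move=> fde; rewrite fM fde -fM mulgV. Qed.

Let rotD k l : f (rot (k + l)%R) = f (rot k) \o f (rot l).
Proof. by rewrite -fM. Qed.

(** A reflection in the kernel makes every rotation equal to its inverse, so
    that the image has order at most two. *)
Lemma dihedral_of_reflection k :
  f (refl k) = id -> (exists2 a, Aut_map M a & a <> id) -> dihedral_Aut M.
Proof.
move=> fk [a]; rewrite -f_range => -[d0 _ <-] fd0.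
have rotN l : f (rot (- l)%R) = f (rot l).
  have: f (refl k * rot l) = f (rot (- l)%R * refl k).
    by rewrite !DihE GRing.addrC.
  by rewrite !fM fk.
have rot2 : f (rot 1) \o f (rot 1) = id by rewrite -{2}rotN -rotD GRing.subrr.
have rotP l : f (rot l) = id \/ f (rot l) = f (rot 1).
  elim/int_rect: l => [|n|n]; first by left.
    by rewrite -addn1 PoszD rotD => -[->|->]; rewrite ?rot2; [right|left].
  rewrite -addn1 PoszD GRing.opprD rotD (rotN 1%R) => -[->|->]; first by right.
  by left.
have fP d : f d = id \/ f d = f (rot 1).
  case: d => l []; last exact: rotP.
  have -> : refl l = rot (l - k)%R * refl k.
    by rewrite DihE /= GRing.subrK.
  by rewrite fM fk; exact: rotP.
have r1 : f (rot 1) <> id by move=> r1; apply: fd0; have [] := fP d0; rewrite ?r1.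
left; exists 0%N, (fun d : Dih 'I_1 => if d.2 then f (rot 1) else id); split.
- by move=> [i []] [j []] //=; rewrite ?(ord1 i) ?(ord1 j) //= => e; case: r1.
- by move=> [i []] [j []] /=; rewrite ?rot2.
apply/seteqP; split=> [_ [[i []] _ <-] /=|]; rewrite -f_range.
- by exists (rot 1).
- by exists 1.
by move=> _ [d _ <-]; have [->|->] := fP d; [exists (0%R, false)|exists (0%R, true)].
Qed.

(** If no reflection is in the kernel, the kernel is generated by its smallest
    positive rotation [n.+1], and the image is dihedral of order [2 * n.+1]. *)
Lemma dihedral_of_rotation n : (forall k, f (refl k) <> id) ->
    f (rot n.+1) = id -> (forall m : nat, f (rot m.+1) = id -> (n <= m)%N) ->
  dihedral_Aut M.
Proof.
move=> nrefl fn n_min; left; exists n.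
have fnM (q : int) : f (rot (q * n.+1)%R) = id.
  elim/int_rect: q => [|q IH|q IH]; first by rewrite GRing.mul0r.
    by rewrite -addn1 PoszD GRing.mulrDl rotD GRing.mul1r IH fn.
  rewrite -addn1 PoszD GRing.opprD GRing.mulrDl rotD IH GRing.mulN1r.
  exact: (fV fn).
have fmod k s : f ((k %% n.+1)%Z, s) = f (k, s).
  have -> : (k, s) = rot ((k %/ n.+1)%Z * n.+1)%R * ((k %% n.+1)%Z, s) :> Dih int.
    by rewrite DihE /= -divz_eq.
  by rewrite fM fnM.
pose phi (d : Dih 'I_n.+1) : M -> M := f (Posz d.1, d.2).
have phiE k s : phi (inZp `|(k %% n.+1)%Z|%N, s) = f (k, s).
  rewrite /phi /= modn_small; last first.
    by rewrite -ltz_nat gez0_abs ?modz_ge0 // ltz_pmod.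
  by rewrite gez0_abs ?modz_ge0 // fmod.
exists phi; split.
- have rot_inj (i j : 'I_n.+1) : f (rot (Posz i - Posz j)) = id -> (j <= i)%N.
    move=> fij; rewrite leqNgt; apply/negP => ij.
    have /n_min : f (rot (j - i).-1.+1) = id.
      rewrite prednK ?subn_gt0 // -subzn ?(ltnW ij) // -GRing.opprB.
      exact: (fV fij).
    by have := ltn_ord j; lia.
  have phi_inj (i j : 'I_n.+1) : f (rot (Posz i - Posz j)) = id -> i = j.
    move=> fij; apply/val_inj/anti_leq; rewrite !rot_inj //.
    by rewrite -GRing.opprB; exact: (fV fij).
  move=> [i s] [j t] /fF; rewrite /=.
  by case: s; case: t => fij; [|case: (nrefl _ fij)|case: (nrefl _ fij)|];
    rewrite (phi_inj _ _ fij).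
- have fmodn (k : nat) s : f (Posz (k %% n.+1)%N, s) = f (Posz k, s).
    by rewrite -[RHS]fmod modz_nat.
  move=> [i s] [j t]; rewrite /phi -fM DihE; case: s => /=; last first.
    by rewrite fmodn PoszD.
  rewrite modnDmr fmodn.
  have -> : (Posz (i + (n.+1 - j)), ~~ t)
      = rot n.+1 * (Posz i - Posz j, ~~ t)%R :> Dih int.
    by rewrite DihE; congr pair; have := ltn_ord j; lia.
  by rewrite fM fn.
apply/seteqP; split=> [_ [d _ <-]|]; rewrite -f_range.
  by exists (Posz d.1, d.2).
by move=> _ [[k s] _ <-]; exists (inZp `|(k %% n.+1)%Z|%N, s).
Qed.

Lemma dihedral_of_hom : (exists2 a, Aut_map M a & a <> id) -> dihedral_Aut M.
Proof.
move=> ntriv.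
have [[k fk]|nrefl] := pselect (exists k, f (refl k) = id).
  exact: dihedral_of_reflection fk ntriv.
have [ex_rot|nrot] := pselect (exists m : nat, `[< f (rot m.+1) = id >]).
  case: (ex_minnP ex_rot) => n /asboolP fn n_min.
  apply: (dihedral_of_rotation _ fn) => [k fk|m fm]; first by apply: nrefl; exists k.
  exact/n_min/asboolP.
right; exists f; split=> // d e /fF fde; apply/divg1_eq.
move: fde; case: (d / e) => k [] fk; first by case: nrefl; exists k.
case: k fk => [[|m]|m] fk //; case: nrot; exists m; apply/asboolP => //.
exact: (fV fk).
Qed.
End DihedralQuotient.

(** * Tame classes *)

(** A Schreier argument: the hypothesis on [u * R i] says that the group generated
    by [g1], [g2] and the stabiliser of [x] has no cosets but those of [1] and
    [t].  As [t] is outside the normaliser or trivial, every element of the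
    normaliser is, modulo the stabiliser of [x], a word in [g1] and [g2].
    So the automorphism group is a quotient of the infinite dihedral group. *)
Lemma dihedral_criterion (M : Map) (x : M) (g1 g2 t : gamma) :
    normaliser_set (map_subgroup x) g1 -> normaliser_set (map_subgroup x) g2 ->
    g1 * g1 = 1 -> g2 * g2 = 1 ->
    (forall i u, u = 1 \/ u = t -> exists e v,
       [/\ u * R i = e * v, [\/ act x e = x, e = g1 | e = g2]
         & v = 1 \/ v = t]) ->
    (normaliser_set (map_subgroup x) t -> t = 1) ->
    (exists2 g, normaliser_set (map_subgroup x) g & act x g <> x) ->
  dihedral_Aut M.
Proof.
move=> Ng1 Ng2 g11 g22 step Nt [g0 Ng0 xg0].
pose phi := dihedral_hom g1 g2.
have phiM d e : phi (d * e) = phi d * phi e by exact: dihedral_homM.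
have Nphi d : normaliser_set (map_subgroup x) (phi d).
  apply: normaliserM; first exact/normaliser_zexp/normaliserM.
  by case: d => k [] //=; exact: normaliser1.
have phi1 : phi (1%R, true) = g1 by rewrite /phi /dihedral_hom /= expg1 -mulgA g22 mulg1.
have phi2 : phi (0%R, true) = g2 by rewrite /phi /dihedral_hom /= expg1 mul1g.
have reach g : exists d u, act x g = act x (phi d * u) /\ (u = 1 \/ u = t).
  elim/gamma_ind: g => [|g i [d [u [IH /(step i)[e [v [uR eP vP]]]]]]].
    by exists 1, 1; split; [rewrite /phi /dihedral_hom /= !mulg1|left].
  rewrite actM IH -actM -mulgA uR.
  case: eP => [xe|->|->].
  - exists d, v; split=> //; rewrite mulgA actM [RHS]actM; congr (act _ v).
    by rewrite -[phi d in RHS]mulg1; apply/normaliser_act => //; rewrite act1.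
  - by exists (d * ((1%R, true) : Dih int)), v; rewrite phiM phi1 mulgA.
  - by exists (d * ((0%R, true) : Dih int)), v; rewrite phiM phi2 mulgA.
have reachN g : normaliser_set (map_subgroup x) g ->
    exists d, act x g = act x (phi d).
  move=> Ng; have [d [u [xg uP]]] := reach g.
  exists d; suff u1 : u = 1 by rewrite xg u1 mulg1.
  case: uP => // ut; rewrite ut; apply: Nt; rewrite -ut.
  have -> : u = (phi d)^-1 * ((phi d * u) * g^-1) * g by rewrite mulgA mulgVK mulKg.
  apply: normaliserM => //; apply: normaliserM; first exact: normaliserV.
  by apply: stabiliser_normalises; apply/act_div.
apply: (@dihedral_of_hom M (fun d => aut_of x (phi d))).
- by move=> d e; rewrite phiM aut_ofM.
- apply/seteqP; split=> [_ [d _ <-]|a]; first exact: aut_ofP.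
  move=> /Aut_map_aut_of-/(_ x)[g Ng ->]; have [d xg] := reachN g Ng.
  exists d => //; apply: (@Aut_map_inj M x); [exact: aut_ofP..|].
  by rewrite !aut_of_base.
exists (aut_of x g0); first exact: aut_ofP.
by move=> /(congr1 (fun a => a x)); rewrite aut_of_base.
Qed.

(** If the normaliser fixed [x], the stabiliser of [x] would have index two, hence
    be normal in [gamma], and the normaliser would be everything. *)
Lemma index2_moves (M : Map) (x : M) (chi : gamma -> bool) t :
    {morph chi : x y / x * y >-> x (+) y} ->
    (forall g, normaliser_set (map_subgroup x) g <-> chi g = false) ->
    chi t -> 
  exists2 g, normaliser_set (map_subgroup x) g & act x g <> x.
Proof.
move=> chiM NP ct; apply: contrapT => fixN.
have xN g : act x g = x <-> chi g = false.
  split=> [/stabiliser_normalises/NP //|/NP Ng].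
  by apply: contrapT => xg; apply: fixN; exists g.
have /NP : normaliser_set (map_subgroup x) t; last by rewrite ct.
apply/normaliserP => h; rewrite -act_div !xN !chiM (parityV chiM) ct.
by case: (chi h).
Qed.

Lemma tame_C1 (M : Map) :
  in_class C1 M -> has_boundary M -> ~ one_flag M -> dihedral_Aut M.
Proof.
move=> /in_class_normaliser[H -> NP] [i [x xi]] many.
have N g : normaliser_set (map_subgroup x) g by have [h ->] := NP x.
have [j [k gen]] : exists j k, forall l, [\/ l = i, l = j | l = k].
  move: i {xi}; apply: I3_cases.
  - by exists (inord 1), (inord 2); apply: I3_cases; [constructor 1|constructor 2|constructor 3].
  - by exists (inord 0), (inord 2); apply: I3_cases; [constructor 2|constructor 1|constructor 3].
  - by exists (inord 0), (inord 1); apply: I3_cases; [constructor 2|constructor 3|constructor 1].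
apply: (@dihedral_criterion M x (R j) (R k) 1) => //; try exact: R_sq.
  move=> l _ [] ->; exists (R l), 1; rewrite mul1g mulg1; split=> //; try by left.
    by have [->|->|->] := gen l; [constructor 1|constructor 2|constructor 3].
  by have [->|->|->] := gen l; [constructor 1|constructor 2|constructor 3].
apply: contrapT => fix_all; apply: many => y z.
have fixg g : act x g = x by apply: contrapT => xg; apply: fix_all; exists g.
by have [g <-] := act_trans x y; have [h <-] := act_trans x z; rewrite !fixg.
Qed.

(** Write [a], [b], [r] for [R i], [R j], [R (inord 1)], with [b] outside and [r]
    inside the normaliser.  The coset representatives [1] and [b] give Schreier
    generators [a], [r], [r ^ b] if [a] is in the normaliser, and [a * b], [r],
    [r ^ b] otherwise; all are involutions, and one that fixes [x]
    is trivial modulo the stabiliser. *)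
Section TameIndex2.
Variables (M : Map) (x : M) (chi : gamma -> bool) (i j : 'I_3).
Hypothesis gen : forall k, [\/ k = i, k = j | k = inord 1].
Hypothesis ab : R i * R j = R j * R i.
Hypothesis chiM : {morph chi : x y / x * y >-> x (+) y}.
Hypothesis NP : forall g, normaliser_set (map_subgroup x) g <-> chi g = false.
Hypothesis cj : chi (R j).
Hypothesis cr : chi (R (inord 1)) = false.

Let a := R i.
Let b := R j.
Let r := R (inord 1).

Let b_out : normaliser_set (map_subgroup x) b -> b = 1.
Proof. by move=> /NP; rewrite cj. Qed.

Let Nrb : normaliser_set (map_subgroup x) (r ^ b).
Proof. by apply/NP; rewrite parityJ. Qed.

Let Nr : normaliser_set (map_subgroup x) r.
Proof. exact/NP. Qed.

Let rbrb : r ^ b * r ^ b = 1.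
Proof. by rewrite -conjMg R_sq conj1g. Qed.

Let rb : b * r = r ^ b * b.
Proof. by rewrite conjgE -mulgA -mulgA R_sq mulg1 R_inv. Qed.

Lemma tame_2_r : chi a = false -> act x r = x -> dihedral_Aut M.
Proof.
move=> ca xr; apply: (@dihedral_criterion M x a (r ^ b) b) => //.
- exact/NP.
- exact: R_sq.
- move=> k _ [] ->; have [->|->|->] := gen k.
  + by exists a, 1; rewrite mul1g mulg1; split=> //; [constructor 2|left].
  + by exists 1, b; split=> //; [constructor 1; rewrite act1|right].
  + by exists r, 1; rewrite mul1g mulg1; split=> //; [constructor 1|left].
  + by exists a, b; split=> //; [constructor 2|right].
  + by exists 1, 1; split; [rewrite R_sq mulg1|constructor 1; rewrite act1|left].
  + by exists (r ^ b), b; split=> //; [constructor 3|right].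
- exact: index2_moves NP cj.
Qed.

Lemma tame_2_a : chi a = false -> act x a = x -> dihedral_Aut M.
Proof.
move=> ca xa; apply: (@dihedral_criterion M x r (r ^ b) b) => //.
- exact: R_sq.
- move=> k _ [] ->; have [->|->|->] := gen k.
  + by exists a, 1; rewrite mul1g mulg1; split=> //; [constructor 1|left].
  + by exists 1, b; split=> //; [constructor 1; rewrite act1|right].
  + by exists r, 1; rewrite mul1g mulg1; split=> //; [constructor 2|left].
  + by exists a, b; split=> //; [constructor 1|right].
  + by exists 1, 1; split; [rewrite R_sq mulg1|constructor 1; rewrite act1|left].
  + by exists (r ^ b), b; split=> //; [constructor 3|right].
- exact: index2_moves NP cj.
Qed.

Lemma tame_2P_r : chi a -> act x r = x -> dihedral_Aut M.
Proof.
move=> ca xr; apply: (@dihedral_criterion M x (a * b) (r ^ b) b) => //.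
- by apply/NP; rewrite chiM ca cj.
- have e : a * b * (b * a) = 1 by rewrite -mulgA (mulgA b) R_sq mul1g R_sq.
  by rewrite -[RHS]e; congr (_ * _); exact: ab.
- move=> k _ [] ->; have [->|->|->] := gen k.
  + exists (a * b), b; rewrite mul1g -mulgA R_sq mulg1.
    by split=> //; [constructor 2|right].
  + by exists 1, b; split=> //; [constructor 1; rewrite act1|right].
  + by exists r, 1; rewrite mul1g mulg1; split=> //; [constructor 1|left].
  + by exists (a * b), 1; rewrite mulg1; split=> //; [constructor 2|left].
  + by exists 1, 1; split; [rewrite R_sq mulg1|constructor 1; rewrite act1|left].
  + by exists (r ^ b), b; split=> //; [constructor 3|right].
- exact: index2_moves NP cj.
Qed.

End TameIndex2.


(** * Maps obtained from voltages *)

Lemma gamma_hom1 (G : groupType) (h : 'I_3 -> G) :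
  (forall r, r \in relators -> \prod_(i <- r) h i = 1) -> gamma_hom h 1 = 1.
Proof. by move=> hr; rewrite -[1]/(gamma_of [::]) (gamma_hom_of hr) big_nil. Qed.

Lemma E_subgroup : is_subgroup E.
Proof.
split=> [|x y Ex Ey] C [CG sub]; first by case: CG.
by case: (CG) => _; apply; [exact: Ex|exact: Ey].
Qed.

Lemma E_gen i : i != inord 1 -> E (R i).
Proof.
move=> i1 C [_ sub]; apply: sub; move: i i1.
by apply: I3_cases; rewrite ?eqxx // => _; [left|right].
Qed.

(** The involution [R 1] forces the voltages at the two ends of each of its orbits
    to be opposite.  [R 0] and [R 2] carry no voltage, so that the edges are the
    fibres of the projection to [A] and translations permute them transitively. *)
Section Cover.
Variables (B : finType) (A : finZmodType).
Variables (rb : 'I_3 -> {perm B}) (vol : B -> A) (b0 : B).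

Definition cover_fun i (x : B * A) : B * A :=
  (rb i x.1, x.2 + (if i == inord 1 then vol x.1 else 0))%R.

Lemma cover_fun_inj i : injective (cover_fun i).
Proof. by move=> [b a] [c d] [/perm_inj <- /GRing.addIr <-]. Qed.

Definition cover_perm i : {perm B * A} := perm (@cover_fun_inj i).

Hypothesis rb_rel : forall r, r \in relators -> \prod_(i <- r) rb i = 1.
Hypothesis volK : forall b, (vol b + vol (rb (inord 1) b) = 0)%R.

Lemma cover_rel r : r \in relators -> \prod_(i <- r) cover_perm i = 1.
Proof.
have n01 : inord 0 != inord 1 :> 'I_3 by rewrite -val_eqE /= !inordK.
have n21 : inord 2 != inord 1 :> 'I_3 by rewrite -val_eqE /= !inordK.
move=> rr; have rbr b := congr1 (fun s : {perm B} => s b) (rb_rel rr).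
apply/permP => -[b a]; move: rr (rbr b).
rewrite !inE => /or4P[] /eqP ->; rewrite !big_cons !big_nil !mulg1 !permM !permE;
  rewrite /cover_fun /= ?(negbTE n01) ?(negbTE n21) ?eqxx ?GRing.addr0 => -> //.
by rewrite -GRing.addrA volK GRing.addr0.
Qed.

Definition cover_act (x : B * A) (g : gamma) : B * A := gamma_hom cover_perm g x.

Lemma cover_act1 x : cover_act x 1 = x.
Proof. by rewrite /cover_act (gamma_hom1 cover_rel) perm1. Qed.

Lemma cover_actM x g h : cover_act x (g * h) = cover_act (cover_act x g) h.
Proof. by rewrite /cover_act (gamma_homM cover_rel) permM. Qed.

Lemma cover_actR x i : cover_act x (R i) = cover_fun i x.
Proof. by rewrite /cover_act (gamma_homR cover_rel) permE. Qed.

Lemma cover_act_fst x g : (cover_act x g).1 = gamma_hom rb g x.1.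
Proof.
elim/gamma_ind: g => [|g i IH]; first by rewrite cover_act1 (gamma_hom1 rb_rel) perm1.
by rewrite cover_actM cover_actR /= IH (gamma_homM rb_rel) permM (gamma_homR rb_rel).
Qed.

Definition translation (c : A) (x : B * A) : B * A := (x.1, c + x.2)%R.

Lemma cover_act_translation c x g :
  translation c (cover_act x g) = cover_act (translation c x) g.
Proof.
elim/gamma_ind: g => [|g i IH]; first by rewrite !cover_act1.
rewrite !cover_actM -IH !cover_actR /translation /cover_fun /=.
by rewrite GRing.addrA.
Qed.

Hypothesis V4_trans : forall b, b \in
  [:: b0; rb (inord 0) b0; rb (inord 2) b0; rb (inord 2) (rb (inord 0) b0)].
(* The voltages generate [A], so that the cover is connected. *)
Hypothesis vol_gen : forall S : set A, S 0%R ->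
  (forall a b, S a -> S (a + vol b)%R) -> forall a, S a.

Lemma cover_level b a : exists2 g, E g & cover_act (b0, a) g = (b, a).
Proof.
have [E1 EB] := E_subgroup.
have n01 : inord 0 != inord 1 :> 'I_3 by rewrite -val_eqE /= !inordK.
have n21 : inord 2 != inord 1 :> 'I_3 by rewrite -val_eqE /= !inordK.
have := V4_trans b; rewrite !inE => /or4P[] /eqP ->.
- by exists 1; rewrite ?cover_act1.
- exists (R (inord 0)); first exact: E_gen.
  by rewrite cover_actR /cover_fun (negbTE n01) /= GRing.addr0.
- exists (R (inord 2)); first exact: E_gen.
  by rewrite cover_actR /cover_fun (negbTE n21) /= GRing.addr0.
exists (R (inord 0) * R (inord 2)).
  by rewrite -[R (inord 2)]R_inv; apply: EB; exact: E_gen.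
rewrite cover_actM !cover_actR /cover_fun (negbTE n21) (negbTE n01) /=.
by rewrite !GRing.addr0.
Qed.

Lemma cover_reach a : exists g, cover_act (b0, 0%R) g = (b0, a).
Proof.
move: a; apply: vol_gen => [|a b [g ga]]; first by exists 1; rewrite cover_act1.
have [h _ hb] := cover_level b a.
have [k _ kb] := cover_level (rb (inord 1) b) (a + vol b)%R.
exists (g * h * R (inord 1) * k^-1); rewrite !cover_actM ga hb cover_actR.
rewrite /cover_fun eqxx /= -kb -cover_actM mulgV cover_act1.
by [].
Qed.

Lemma cover_trans x y : exists g, cover_act x g = y.
Proof.
have base z : exists g, cover_act (b0, 0%R) g = z.
  case: z => b a; have [g ga] := cover_reach a; have [h _ hb] := cover_level b a.
  by exists (g * h); rewrite cover_actM ga.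
have [g <-] := base x; have [h <-] := base y.
by exists (g^-1 * h); rewrite -cover_actM mulVKg.
Qed.

Lemma cover_nonempty : exists x : B * A, True.
Proof. by exists (b0, 0%R). Qed.

Definition cover_map : Map :=
  MkMap cover_act1 cover_actM cover_nonempty cover_trans.

Let x0 : cover_map := (b0, 0%R).

Hypothesis b0_fix : rb (inord 1) b0 = b0.
Hypothesis vol_b0 : vol b0 = 0%R.
Hypothesis b0_uniq : forall b, rb (inord 1) b = b -> vol b = 0%R -> b = b0.

Lemma translation_Aut c : Aut_map cover_map (translation c).
Proof.
split; last by move=> x g; exact: cover_act_translation.
exists (translation (- c)%R) => -[b a]; rewrite /translation /=.
  by rewrite GRing.addKr.
by rewrite GRing.addNKr.
Qed.

Lemma cover_R1 : act x0 (R (inord 1)) = x0.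
Proof. by rewrite /= cover_actR /cover_fun eqxx /= b0_fix vol_b0 GRing.addr0. Qed.

(** The flags above [b0] are exactly those fixed by [R 1], so every automorphism
    permutes them, and translations do so transitively. *)
Lemma cover_Aut a : Aut_map cover_map a -> exists c, a = translation c.
Proof.
move=> aA; have: act (a x0) (R (inord 1)) = a x0 by rewrite -aA.2 cover_R1.
case ax: (a x0) => [b c]; rewrite /= cover_actR /cover_fun eqxx /= => -[rbb volb].
exists c; apply: (@Aut_map_inj cover_map x0) => //; first exact: translation_Aut.
rewrite ax /translation /= GRing.addr0 (b0_uniq rbb) //.
by apply: (@GRing.addrI _ c); rewrite volb GRing.addr0.
Qed.

Lemma cover_normaliser :
  normaliser_set (map_subgroup x0) = [set g | gamma_hom rb g b0 = b0].
Proof.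
apply/seteqP; split=> g /=.
  move=> /normaliser_AutP[_ /cover_Aut[c ->]] /(congr1 fst).
  by rewrite [act _ _]/= cover_act_fst.
move=> rg; apply/normaliser_AutP; exists (translation (act x0 g).2).
  exact: translation_Aut.
by rewrite [RHS]surjective_pairing [act _ _]/= cover_act_fst rg /translation /= GRing.addr0.
Qed.

Lemma cover_edge_transitive : edge_transitive cover_map.
Proof.
have [E1 EB] := E_subgroup.
have EV g : E g -> E g^-1 by move=> Eg; rewrite -[_^-1]mul1g; exact: EB.
have EM g h : E g -> E h -> E (g * h).
  by move=> Eg Eh; rewrite -[h]invgK; apply: EB => //; exact: EV.
have edgeE (x y : cover_map) h : E h -> act x h = y ->
    [set act x g | g in E] = [set act y g | g in E].
  move=> Eh xh; apply/seteqP; split=> _ [g Eg <-].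
    by exists (h^-1 * g); [apply: EM => //; exact: EV|rewrite -xh -actM mulVKg].
  by exists (h * g); [exact: EM|rewrite actM xh].
have edge0 (b : B) (a : A) : [set act ((b, a) : cover_map) g | g in E] =
    [set act ((b0, a) : cover_map) g | g in E].
  by have [h Eh hb] := cover_level b a; rewrite (edgeE (b0, a) (b, a) h).
move=> _ _ [[b a] _ <-] [[c d] _ <-]; exists (translation (d - a)%R).
  exact: translation_Aut.
have aM := (translation_Aut (d - a)%R).2.
rewrite !edge0; apply/seteqP; split=> [_ [_ [g Eg <-] <-]|_ [g Eg <-]].
  by exists g => //; rewrite aM /translation /= GRing.subrK.
exists (act ((b0, a) : cover_map) g); first by exists g.
by rewrite aM /translation /= GRing.subrK.
Qed.

Lemma cover_boundary : has_boundary cover_map.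
Proof. by exists (inord 1), x0; exact: cover_R1. Qed.

Lemma cover_in_class T :
  is_N T [set g | gamma_hom rb g b0 = b0] -> in_class T cover_map.
Proof.
move=> TN; split; first exact: cover_edge_transitive.
exists x0, [set g | gamma_hom rb g b0 = b0]; split=> //.
exists 1; rewrite cover_normaliser; apply/seteqP; split=> [_ [g xg <-]|g xg].
  by rewrite conjg1.
by exists g; rewrite ?conjg1.
Qed.

(** Since translations commute, a dihedral automorphism group would be abelian; then
    inversion is trivial on its cyclic subgroup of rotations, which has order at
    most two. *)
Lemma cover_not_dihedral : (4 < #|A|)%N -> ~ dihedral_Aut cover_map.
Proof.
move=> A4.
have comm (C : zmodType) : Aut_isog cover_map (Dih C) -> forall k : C, k = (- k)%R.
  move=> [phi [phi_inj phiM phiA]] k.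
  have phiT d : exists c, phi d = translation c.
    by apply: cover_Aut; rewrite -phiA; exists d.
  have phiC d e : phi (d * e) = phi (e * d).
    rewrite !phiM; have [c ->] := phiT d; have [c' ->] := phiT e.
    by apply/funext => x; rewrite /translation /= !GRing.addrA [(c + c')%R]GRing.addrC.
  have /phi_inj := phiC (k, false) (0%R, true).
  by rewrite !DihE /= GRing.addr0 GRing.add0r => -[].
case=> [[n iso]|/comm/(_ 1%R)//].
have n1 : (n <= 1)%N.
  case: n iso => [|[|n]] // /comm/(_ (inord 1)) /(congr1 val) /=.
  by rewrite inordK // modn_small // subn1.
have [phi [phi_inj _ phiA]] := iso.
have /choice[d phid] c : exists d, phi d = translation c.
  have := translation_Aut c; rewrite -phiA => -[d _ <-]; by exists d.
have: (#|A| <= #|{: 'I_n.+1 * bool}|)%N.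
  apply: (@leq_card _ _ (d : A -> 'I_n.+1 * bool)) => c c' /(congr1 phi).
  rewrite !phid => /(congr1 (fun f => (f x0).2)).
  by rewrite /translation /= !GRing.addr0.
by rewrite card_prod card_ord card_bool; lia.
Qed.

Lemma cover_wild T : (4 < #|A|)%N ->
  is_N T [set g | gamma_hom rb g b0 = b0] -> wild_class T.
Proof.
move=> A4 TN; exists cover_map; split; [exact: cover_in_class|exact: cover_boundary| |].
  move=> one; suff: (#|A| <= #|{: unit}|)%N by rewrite card_unit leqNgt (ltnW (ltnW (ltnW A4))).
  apply: (@leq_card _ _ (fun=> tt)) => c c' _.
  by have [] := one (b0, c) (b0, c').
exact: cover_not_dihedral.
Qed.

End Cover.

(** * Wild classes *)

Lemma action4_V4_trans s (b0 b : 'I_4) : b \in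
  [:: b0; action4 s (inord 0) b0; action4 s (inord 2) b0;
      action4 s (inord 2) (action4 s (inord 0) b0)].
Proof.
rewrite -(mem_map val_inj) /action4 /= !inordK // !permM !tp_val //.
by case: b0 b => [[|[|[|[|//]]]] ?] [[|[|[|[|//]]]] ?].
Qed.

Lemma Z6_gen (S : set 'Z_6) :
  S 0%R -> (forall a, S a -> S (a + 1)%R) -> forall a, S a.
Proof.
move=> S0 S1 a; rewrite -[a]natr_Zp; elim: (a : nat) => [//|n IH].
by rewrite GRing.mulrSr; exact: S1.
Qed.

Lemma action4_wild T s (A : finZmodType) (vol : 'I_4 -> A) (b0 : 'I_4) :
    (forall H, point_stabiliser4 s H -> is_N T H) ->
    (4 < #|A|)%N -> s * s = 1 ->
    (forall b, (vol b + vol (s b) = 0)%R) ->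
    (forall S : set A, S 0%R -> (forall a b, S a -> S (a + vol b)%R) ->
      forall a, S a) ->
    (forall b, s b = b /\ vol b = 0%R <-> b = b0) ->
  wild_class T.
Proof.
move=> TN A4 ss volK vol_gen b0P.
have s1 : action4 s (inord 1) = s by rewrite /action4 /= inordK.
have [sb0 vb0] := (b0P b0).2 erefl.
apply: (@cover_wild _ A (action4 s) vol b0 (action4_rel ss)) => //.
- by move=> b; rewrite s1.
- exact: action4_V4_trans.
- by rewrite s1.
- by move=> b; rewrite s1 => sb vb; apply/b0P.
- by apply: TN; exists b0.
Qed.

(** Here [R 1] fixes all four points, and the stabiliser of a point is the free
    product of four groups of order two, generated by conjugates of [R 1].  The
    voltages kill one of these four involutions and make the others independent. *)
Lemma wild_C3 : wild_class C3.
Proof.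
pose vol (b : 'I_4) : 'rV['Z_2]_3 :=
  if unlift ord0 b is Some j then delta_mx 0%R j else 0%R.
apply: (@action4_wild _ 1 'rV['Z_2]_3 vol ord0) => //.
- by rewrite card_mx card_ord.
- by rewrite mulg1.
- move=> b; rewrite perm1; apply/rowP => j; rewrite !mxE.
  by rewrite -GRing.mulr2n -GRing.mulr_natr (_ : 2%:R = 0 :> 'Z_2)%R ?GRing.mulr0 //;
     apply/eqP.
- move=> S S0 Sv v; rewrite [v]row_sum_delta.
  apply: big_rec => // j x _ Sx; rewrite -[v _ _]natr_Zp GRing.scaler_nat.
  elim: (v _ _ : nat) => [|n IH]; first by rewrite GRing.mulr0n GRing.add0r.
  rewrite GRing.mulrSr GRing.addrAC.
  by have := Sv _ (lift ord0 j) IH; rewrite /vol liftK.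
- move=> b; rewrite perm1; split=> [[_]|->]; last by rewrite /vol unlift_none.
  rewrite /vol; case: unliftP => [j _|//] /rowP/(_ j).
  by rewrite !mxE !eqxx.
Qed.

(** Here [R 1] swaps two points of four and fixes the others.  The swapped ones get
    opposite voltages generating
    ['Z_6], one fixed point gets the involution [3] and the other, [k0], gets
    voltage zero, which tells the two fixed points apart. *)
Lemma wild_transposition T i j (v : seq 'Z_6) (k0 : nat) :
    (forall H, point_stabiliser4 (tp i j) H -> is_N T H) ->
    (0 < i <= 4)%N -> (0 < j <= 4)%N -> (k0 < 4)%N ->
    let swap k := if k == i.-1 then j.-1 else if k == j.-1 then i.-1 else k in
    all (fun k => [&& swap (swap k) == k, v`_k + v`_(swap k) == 0
      & ((swap k == k) && (v`_k == 0)) == (k == k0)])%R (iota 0 4) ->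
    has (fun k => v`_k == 1)%R (iota 0 4) ->
  wild_class T.
Proof.
move=> TN iP jP k04 swap /allP vP /hasP[k1 k14 /eqP v1].
have sE (b : 'I_4) : val (tp i j b) = swap b by exact: tp_val.
have {}vP (b : 'I_4) : [&& swap (swap b) == b, v`_b + v`_(swap b) == 0
      & ((swap b == b) && (v`_b == 0)) == (val b == k0)]%R.
  by apply: vP; rewrite mem_iota ltn_ord.
move: k14; rewrite mem_iota => /= k14.
apply: (@action4_wild _ (tp i j) 'Z_6 (fun b => v`_b)%R (Ordinal k04)) => //.
- by rewrite card_ord.
- apply/permP => b; apply/val_inj; rewrite permM perm1 !sE.
  by have /and3P[/eqP] := vP b.
- by move=> b; rewrite sE; have /and3P[_ /eqP] := vP b.
- move=> S S0 Sv; apply: Z6_gen => // a Sa.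
  by rewrite -v1; exact: (Sv a (Ordinal k14)).
move=> b; have /and3P[_ _ /eqP bP] := vP b; rewrite -sE val_eqE in bP.
split=> [[/eqP sb /eqP vb]|/eqP bk].
  by apply/val_inj/eqP; rewrite -bP sb vb.
by have : val b == k0 by []; rewrite -bP => /andP[/eqP ? /eqP ?].
Qed.

Lemma wild_C4 : wild_class C4.
Proof. exact: (@wild_transposition _ 1 4 [:: 1; 0; 3; -1]%R 1). Qed.

Lemma wild_C4star : wild_class C4star.
Proof. exact: (@wild_transposition _ 1 2 [:: 1; -1; 0; 3]%R 2). Qed.

Lemma wild_C4P : wild_class C4P.
Proof. exact: (@wild_transposition _ 1 3 [:: 1; 0; -1; 3]%R 1). Qed.

(** * Maps with boundary in the tame classes *)

Lemma boundary_C1 : exists2 M, in_class C1 M & has_boundary M.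
Proof.
have rel r : r \in relators -> \prod_(i <- r) (1 : {perm unit}) = 1.
  by move=> _; apply: big1_eq.
have volK (b : unit) : ((0 : 'I_1) + 0 = 0)%R by rewrite GRing.addr0.
have V4 (b : unit) : b \in [:: tt; (1 : {perm unit}) tt; (1 : {perm unit}) tt;
    (1 : {perm unit}) ((1 : {perm unit}) tt)] by case: b.
have gen (S : set 'I_1) : S 0%R ->
    (forall a (b : unit), S a -> S (a + 0)%R) -> forall a, S a.
  by move=> S0 _ a; rewrite (ord1 a).
exists (@cover_map _ _ (fun=> 1) (fun=> 0%R) tt rel volK V4 gen).
  apply: cover_in_class => [||[]|] //; first by rewrite perm1.
  by apply/seteqP; split=> // g _; rewrite /= unitE.
by apply: cover_boundary => //; rewrite perm1.
Qed.

(** The base is the action on the two cosets of the index-two subgroup; [R 1] fixes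
    both, and a non-zero voltage at one of them tells them apart. *)
Lemma boundary_2 T s :
    (forall H, index2_containing s H -> is_N T H) ->
    1%N \in s -> (0%N \notin s) || (2%N \notin s) ->
  exists2 M, in_class T M & has_boundary M.
Proof.
move=> TN s1 s02.
pose flip : {perm bool} := tperm true false.
have flipE b : flip b = ~~ b by case: b; rewrite ?tpermL ?tpermR.
pose rb (i : 'I_3) : {perm bool} := if val i \in s then 1 else flip.
have rbE i b : rb i b = (val i \notin s) (+) b.
  by rewrite /rb; case: ifP => _; rewrite ?perm1 ?flipE.
have rb1 b : rb (inord 1) b = b by rewrite rbE /= inordK // s1.
pose vol (b : bool) : 'Z_2 := if b then 1%R else 0%R.
have rel r : r \in relators -> \prod_(i <- r) rb i = 1.
  rewrite !inE => /or4P[] /eqP ->; apply/permP => b;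
    rewrite !big_cons big_nil mulg1 !permM perm1 !rbE ?addbA ?addbb //.
  by case: (_ \notin _); case: (_ \notin _); case: b.
have volK b : (vol b + vol (rb (inord 1) b) = 0)%R.
  by rewrite rb1; case: b; apply/eqP.
have V4 b : b \in [:: false; rb (inord 0) false; rb (inord 2) false;
    rb (inord 2) (rb (inord 0) false)].
  rewrite !rbE /= !inordK // !addbF !inE.
  by case: b; case: (0%N \in s) (2%N \in s) s02 => [] [].
have gen (S : set 'Z_2) : S 0%R -> (forall a b, S a -> S (a + vol b)%R) ->
    forall a, S a.
  move=> S0 Sv a; rewrite -[a]natr_Zp; elim: (a : nat) => [//|n IH].
  by rewrite GRing.mulrSr; exact: (Sv _ true).
have uniq b : rb (inord 1) b = b -> vol b = 0%R -> b = false by case: b.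
exists (@cover_map _ _ rb vol false rel volK V4 gen); last by apply: cover_boundary.
apply: cover_in_class => //; apply: TN.
pose chi g := gamma_hom rb g false.
have chiE g b : gamma_hom rb g b = b (+) chi g.
  rewrite /chi; move: b; elim/gamma_ind: g => [|g i IH] b.
    by rewrite (gamma_hom1 rel) !perm1 addbF.
  rewrite (gamma_homM rel) !permM (gamma_homR rel) !rbE IH.
  by rewrite addbCA.
have chiM : {morph chi : x y / x * y >-> x (+) y}.
  by move=> x y; rewrite /chi (gamma_homM rel) permM chiE.
have chiR i : chi (R i) = (val i \notin s).
  by rewrite /chi (gamma_homR rel) rbE addbF.
have HP g : gamma_hom rb g false = false <-> chi g = false by [].
have [|HG H2] := parity_index2 chiM _ HP.
  case/orP: s02 => ns; [exists (R (inord 0))|exists (R (inord 2))];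
  by rewrite chiR /= inordK.
split=> // i; rewrite [X in X <-> _]/= -[gamma_hom rb (R i) false]/(chi (R i)) chiR.
by case: (_ \in s).
Qed.

Lemma tame_class_C1 : tame_class C1.
Proof. by split; [exact: boundary_C1|move=> M; exact: tame_C1]. Qed.

Lemma tame_class_C2 : tame_class C2.
Proof.
split=> [|M TM [k [x xk]] _]; first exact: (@boundary_2 C2 [:: 1; 2]%N).
have [chi [chiM chiR NP]] := index2_normaliser TM (fun H NH => NH).
have := stabiliser_normalises xk; rewrite NP.
have [ca [cb cr]] : chi (R (inord 2)) = false /\ (chi (R (inord 0)) /\ chi (R (inord 1)) = false).
  by rewrite !chiR /= !inordK.
have [ek|ek|ek] := I3_gen20 k; rewrite ek in xk *.
- move=> _; exact: tame_2_a I3_gen20 (esym R02_comm) chiM (NP x) cb cr ca xk.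
- by rewrite cb.
- move=> _; exact: tame_2_r I3_gen20 (esym R02_comm) chiM (NP x) cb cr ca xk.
Qed.

Lemma tame_class_C2star : tame_class C2star.
Proof.
split=> [|M TM [k [x xk]] _]; first exact: (@boundary_2 C2star [:: 0; 1]%N).
have [chi [chiM chiR NP]] := index2_normaliser TM (fun H NH => NH).
have := stabiliser_normalises xk; rewrite NP.
have [ca [cb cr]] : chi (R (inord 0)) = false /\ (chi (R (inord 2)) /\ chi (R (inord 1)) = false).
  by rewrite !chiR /= !inordK.
have [ek|ek|ek] := I3_gen02 k; rewrite ek in xk *.
- move=> _; exact: tame_2_a I3_gen02 R02_comm chiM (NP x) cb cr ca xk.
- by rewrite cb.
- move=> _; exact: tame_2_r I3_gen02 R02_comm chiM (NP x) cb cr ca xk.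
Qed.

Lemma tame_class_C2P : tame_class C2P.
Proof.
split=> [|M TM [k [x xk]] _]; first exact: (@boundary_2 C2P [:: 1]%N).
have [chi [chiM chiR NP]] := index2_normaliser TM (fun H NH => NH).
have := stabiliser_normalises xk; rewrite NP.
have [ca [cb cr]] : chi (R (inord 0)) /\ (chi (R (inord 2)) /\ chi (R (inord 1)) = false).
  by rewrite !chiR /= !inordK.
have [ek|ek|ek] := I3_gen02 k; rewrite ek in xk *.
- by rewrite ca.
- by rewrite cb.
- move=> _; exact: tame_2P_r I3_gen02 R02_comm chiM (NP x) cb cr ca xk.
Qed.

(** * The classification *)

Lemma not_void_tame T : tame_class T -> ~ void_class T.
Proof. by move=> [[M TM bM] _] /(_ M TM). Qed.

Lemma not_void_wild T : wild_class T -> ~ void_class T.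
Proof. by move=> [M [TM bM _ _]] /(_ M TM). Qed.

Lemma not_tame_wild T : wild_class T -> ~ tame_class T.
Proof. by move=> [M [TM bM many ndih]] [_ /(_ M TM bM many)]. Qed.

Theorem theorem17p1 :
  [/\ [set T | void_class T] = [set C2ex; C2starex; C2Pex; C5; C5star; C5P],
      [set T | tame_class T] = [set C1; C2; C2star; C2P]
    & [set T | wild_class T] = [set C3; C4; C4star; C4P]].
Proof.
have voids : [set C2ex; C2starex; C2Pex; C5; C5star; C5P] `<=` void_class.
  move=> T [[[[[->|->]|->]|->]|->]|->].
  - exact: void_C2ex.
  - exact: void_C2starex.
  - exact: void_2Pex.
  - by apply: (@void_5 (tp 1 4 * tp 2 3)) => //; rewrite !inE eqxx.
  - by apply: (@void_5 (tp 1 2 * tp 3 4)) => //; rewrite !inE eqxx ?orbT.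
  - by apply: (@void_5 (tp 1 3 * tp 2 4)) => //; rewrite !inE eqxx ?orbT.
have tames : [set C1; C2; C2star; C2P] `<=` tame_class.
  move=> T [[[->|->]|->]|->].
  - exact: tame_class_C1.
  - exact: tame_class_C2.
  - exact: tame_class_C2star.
  - exact: tame_class_C2P.
have wilds : [set C3; C4; C4star; C4P] `<=` wild_class.
  move=> T [[[->|->]|->]|->].
  - exact: wild_C3.
  - exact: wild_C4.
  - exact: wild_C4star.
  - exact: wild_C4P.
have trichotomy T : [\/ [set C2ex; C2starex; C2Pex; C5; C5star; C5P] T,
    [set C1; C2; C2star; C2P] T | [set C3; C4; C4star; C4P] T].
  by case: T; ((by constructor 1; rewrite /=; tauto) ||
    (by constructor 2; rewrite /=; tauto) || (constructor 3; rewrite /=; tauto)).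
split; apply/seteqP; split=> // T TT; have [v|t|w] := trichotomy T => //.
- by case: (not_void_tame (tames T t)).
- by case: (not_void_wild (wilds T w)).
- by case: (not_void_tame TT (voids T v)).
- by case: (not_tame_wild (wilds T w)).
- by case: (not_void_wild TT (voids T v)).
- by case: (not_tame_wild TT (tames T t)).
Qed.
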